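(* There exists a function $R:\mathbb{N}\times\mathbb{N}\times\mathbb{N}\times(0,1]\to\mathbb{N}$ such that the following holds. Let $G=(V_1,\ldots,V_k,c)$ be a $k$-partite $\Sigma$-chart with $|V_i|=n\geq R(|\Sigma|,k,t,\alpha)$ for every $i$, and let $B\subseteq\bigcup_{1\le i<j\le k}(V_i\times V_j)$ be a set of ``undesirable edges'' with $|B|\leq\epsilon\binom{k}{2}n^2$. Then there exist $W_i\subseteq V_i$ ($1\le i\le k$) such that: $|W_i|=t$ for every $i$; $c$ restricted to $W_i\times W_j$ is constant for every $1\le i<j\le k$; and $\left|B\cap\bigcup_{1\le i<j\le k}(W_i\times W_j)\right|\leq(1+\alpha)\epsilon\binom{k}{2}t^2$.
   Context: For disjoint sets $U,W$, $U\times W$ denotes the set of (unordered) edges $\{u,w\}$ with $u\in U$, $w\in W$. A $k$-partite $\Sigma$-chart $(V_1,\ldots,V_k,c)$ consists of pairwise disjoint vertex sets $V_1,\dots,V_k$ and a coloring $c:\bigcup_{1\le i<j\le k}V_i\times V_j\to\Sigma$ of the edges of the complete $k$-partite graph, $\Sigma$ a finite set. *)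

(* Defs.v *)
From HB Require Import structures.
From mathcomp Require Import all_boot all_order all_algebra.
From mathcomp Require Import reals.

Set Implicit Arguments.
Unset Strict Implicit.
Unset Printing Implicit Defensive.

(* An unordered edge {u, w} is the set [set u; w] : {set T}, where T is a
   finite ambient type containing all the vertices. *)
Definition cross_edges (T : finType) (U W : {set T}) : {set {set T}} :=
  [set [set u; w] | u in U, w in W].

Definition partite_edges (T : finType) (k : nat) (V : 'I_k -> {set T}) :
    {set {set T}} :=
  \bigcup_(i < k) \bigcup_(j < k | i < j) cross_edges (V i) (V j).

Record chart (Sigma T : finType) (k : nat) := Chart {
  part : 'I_k -> {set T};
  part_disjoint : forall i j : 'I_k, i != j -> [disjoint part i & part j];
  color : {e : {set T} | e \in partite_edges part} -> Sigma
}.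

(* Phrased with two edges, so that the restriction of the coloring to an empty
   E is constant even when Sigma is empty. *)
Definition color_constant_on (Sigma T : finType) (k : nat)
    (G : chart Sigma T k) (E : {set {set T}}) : Prop :=
  forall e f : {e : {set T} | e \in partite_edges (part G)},
    val e \in E -> val f \in E -> color e = color f.

(* Main.v *)
(* The density of a family (X_1, ..., X_k) is the sum over i < j of the
   proportion of undesirable pairs in X_i x X_j. It is affine in the uniform
   measure on each X_l, so cutting X_l into blocks of equal size, up to few
   leftover points, yields a block whose choice as the new X_l multiplies the
   density by at most 1 + 1/D. The blocks may also be taken constant for any
   map from X_l to a bounded set, provided X_l is large enough. Such cuts make
   all pairs (X_i, X_j) monochromatic one after the other, and then bring all
   parts to size t. The number of cuts depends on k only, so D can be chosen
   such that the total loss is at most 1 + alpha, whatever the initial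
   density. *)
Require Import Defs.
From HB Require Import structures.
From mathcomp Require Import all_boot all_order all_algebra.
From mathcomp Require Import reals.
From mathcomp Require Import lra.

Set Implicit Arguments.
Unset Strict Implicit.
Unset Printing Implicit Defensive.

Import Order.TTheory GRing.Theory Num.Theory.
Local Open Scope ring_scope.

(** * Pigeonhole and light constant blocks *)

Lemma subset_of_card (T : finType) (A : {set T}) (n : nat) :
  (n <= #|A|)%N -> exists2 B : {set T}, B \subset A & #|B| = n.
Proof.
move=> len; exists [set x in take n (enum A)].
  by apply/subsetP => x; rewrite inE => /mem_take; rewrite mem_enum.
rewrite cardsE; have /card_uniqP -> : uniq (take n (enum A)).
  exact/take_uniq/enum_uniq.
by rewrite size_takel // -cardE.
Qed.

(** Pigeonhole: were every fibre of [h] in [X] to have at most [L.-1] points, [X] would have fewer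
    than [#|Q| * L]. *)
Lemma constant_block (T Q : finType) (h : T -> Q) (X : {set T}) (L : nat) :
  (0 < L)%N -> (0 < #|Q|)%N -> (#|Q| * L <= #|X|)%N ->
  exists Y : {set T},
    [/\ Y \subset X, #|Y| = L & {in Y &, forall x y, h x = h y}].
Proof.
move=> L0 Q0 leX.
have [q leq] : exists q, (L <= #|[set x in X | h x == q]|)%N.
  apply/existsP; apply: contraTT leX; rewrite negb_exists -ltnNge.
  move=> /forallP small.
  rewrite -sum1_card (partition_big h predT) //=.
  apply: (@leq_ltn_trans (\sum_(q : Q) L.-1)).
    apply: leq_sum => q _; rewrite sum1dep_card -ltnS prednK // ltnNge.
    exact: small.
  by rewrite sum_nat_const ltn_pmul2l // prednK.
have [Y YX cY] := subset_of_card leq; exists Y; split=> //.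
  by apply: subset_trans YX _; apply/subsetP => x; rewrite inE => /andP[].
move=> x y /(subsetP YX) + /(subsetP YX); rewrite !inE.
by move=> /andP[_ /eqP->] /andP[_ /eqP->].
Qed.

(* Constant blocks can be removed one after the other until fewer than
   [#|Q| * L] points are left; one of them has to be light. *)
Lemma light_constant_block (R : realFieldType) (T Q : finType) (h : T -> Q)
    (g : T -> R) (X : {set T}) (L : nat) (M : R) :
  (forall x, 0 <= g x) -> 0 <= M ->
  (0 < L)%N -> (0 < #|Q|)%N -> (#|Q| * L <= #|X|)%N ->
  \sum_(x in X) g x <= M * (#|X|%:R - (#|Q| * L)%:R) ->
  exists Y : {set T},
    [/\ Y \subset X, #|Y| = L, {in Y &, forall x y, h x = h y}
      & \sum_(x in Y) g x <= M * L%:R].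
Proof.
move=> g0 M0 L0 Q0.
have [n] := ubnP #|X|; elim: n X => // n IHn X ltX leX leg.
have [Y [YX cY hY]] := constant_block h L0 Q0 leX.
have [?|gtY] := leP (\sum_(x in Y) g x) (M * L%:R); first by exists Y.
have cD : #|X :\: Y| = (#|X| - L)%N by rewrite cardsD (setIidPr YX) cY.
have LX : (L <= #|X|)%N by rewrite -cY subset_leq_card.
(* Removing a block heavier than [M * L%:R] lowers the weight by more than it lowers the bound, so
   the hypothesis survives. *)
have sumD : \sum_(x in X :\: Y) g x <= M * (#|X|%:R - L%:R - (#|Q| * L)%:R).
  move: leg; rewrite (big_setID Y) (setIidPr YX) /= => leg.
  rewrite [X in _ <= M * X]addrAC mulrBr lerBrDl.
  by apply: le_trans leg; rewrite lerD2r ltW.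
have [leD|gtD] := leqP (#|Q| * L)%N #|X :\: Y|.
  have [||Z [ZX cZ hZ leZ]] := IHn (X :\: Y) _ leD.
  - by rewrite cD -ltnS (leq_trans _ ltX) // ltnS ltn_subrL L0 (leq_trans L0).
  - by rewrite cD natrB.
  by exists Z; split=> //; apply: subset_trans ZX (subsetDl _ _).
(* Here [#|X| - #|Q| * L <= L], so a heavy [Y] alone would exceed the bound on the weight of [X]. *)
exists Y; split=> //; exfalso.
move: leg; rewrite (big_setID Y) (setIidPr YX) /= leNgt => /negP; apply.
have : 0 <= \sum_(x in X :\: Y) g x by apply: sumr_ge0.
have : M * (#|X|%:R - (#|Q| * L)%:R) <= M * L%:R.
  apply: ler_wpM2l => //; rewrite lerBlDr -natrD ler_nat.
  by rewrite -leq_subLR -cD ltnW.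
by move=> a b; apply: le_lt_trans a _; rewrite ltr_wpDr.
Qed.

(** * Averages over finite sets and densities of families *)

Section Averages.
Variable R : realFieldType.

Definition avg (T : finType) (X : {set T}) (g : T -> R) : R :=
  (\sum_(x in X) g x) / #|X|%:R.

Lemma avg_ge0 (T : finType) (X : {set T}) (g : T -> R) :
  (forall x, 0 <= g x) -> 0 <= avg X g.
Proof. by move=> g0; rewrite divr_ge0 // sumr_ge0. Qed.

(** In a set this large, [q * L] leftover points are at most a fraction [1 / (D + 1)], and
    [(1 + 1 / D) * (1 - 1 / (D + 1)) = 1]. *)
Definition block_size (D q L : nat) : nat := q * L * D.+1.

Lemma avg_constant_block (T Q : finType) (h : T -> Q) (g : T -> R)
    (X : {set T}) (D L : nat) :
  (forall x, 0 <= g x) -> (0 < D)%N -> (0 < L)%N -> (0 < #|Q|)%N ->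
  (block_size D #|Q| L <= #|X|)%N ->
  exists Y : {set T},
    [/\ Y \subset X, #|Y| = L, {in Y &, forall x y, h x = h y}
      & avg Y g <= (1 + D%:R^-1) * avg X g].
Proof.
move=> g0 D0 L0 Q0 leX.
have X0 : (0 < #|X|)%N by apply: leq_trans leX; rewrite !muln_gt0 Q0 L0.
have a0 : 0 <= avg X g by apply: avg_ge0.
have r0 : 0 < 1 + D%:R^-1 :> R by rewrite addr_gt0 // invr_gt0 ltr0n.
have [||Y [YX cY hY leY]] :=
    @light_constant_block R T Q h g X L ((1 + D%:R^-1) * avg X g)
      g0 (mulr_ge0 (ltW r0) a0) L0 Q0.
- by apply: leq_trans leX; rewrite leq_pmulr.
- have Dn0 : D%:R != 0 :> R by rewrite pnatr_eq0 -lt0n.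
  have Xn0 : #|X|%:R != 0 :> R by rewrite pnatr_eq0 -lt0n.
  have -> : \sum_(x in X) g x = avg X g * #|X|%:R by rewrite divfK.
  rewrite [X in _ <= X * _]mulrC -[leRHS]mulrA ler_wpM2l //.
  have : (#|Q| * L)%:R * (D%:R + 1) <= #|X|%:R :> R.
    by rewrite natr1 -natrM ler_nat.
  have iD : (#|Q| * L)%:R * (D%:R * D%:R^-1) = (#|Q| * L)%:R :> R.
    by rewrite divff // mulr1.
  have iD0 : 0 <= D%:R^-1 :> R by rewrite invr_ge0.
  by move=> le; have := ler_wpM2l iD0 le; lra.
by exists Y; split=> //; rewrite /avg cY ler_pdivrMr ?ltr0n.
Qed.

Definition update (T : finType) (k : nat) (X : 'I_k -> {set T}) (l : 'I_k)
    (Y : {set T}) : 'I_k -> {set T} :=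
  fun i => if i == l then Y else X i.

Definition pair_density (T : finType) (b : T -> T -> R) (U W : {set T}) : R :=
  avg U (fun u => avg W (b u)).

Definition density (T : finType) (k : nat) (b : T -> T -> R)
    (X : 'I_k -> {set T}) : R :=
  \sum_(i < k) \sum_(j < k | (i < j)%N) pair_density b (X i) (X j).

Lemma density_ge0 (T : finType) (k : nat) (b : T -> T -> R)
    (X : 'I_k -> {set T}) :
  (forall u w, 0 <= b u w) -> 0 <= density b X.
Proof.
by move=> b0; do 2!(apply: sumr_ge0 => ? _); do 2!(apply: avg_ge0 => ?).
Qed.

Lemma avg1 (T : finType) (x : T) (g : T -> R) : avg [set x] g = g x.
Proof. by rewrite /avg big_set1 cards1 divr1. Qed.

Lemma avg_const (T : finType) (X : {set T}) (a : R) :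
  (0 < #|X|)%N -> avg X (fun=> a) = a.
Proof.
move=> X0; rewrite /avg sumr_const -[X in X / _]mulr_natr mulfK //.
by rewrite pnatr_eq0 -lt0n.
Qed.

Lemma avg_sum (T : finType) (X : {set T}) (I : finType) (P : pred I)
    (F : I -> T -> R) :
  avg X (fun x => \sum_(i | P i) F i x) = \sum_(i | P i) avg X (F i).
Proof. by rewrite /avg exchange_big mulr_suml. Qed.

Lemma avg_exchange (T S : finType) (X : {set T}) (Y : {set S})
    (F : T -> S -> R) :
  avg X (fun x => avg Y (F x)) = avg Y (fun y => avg X (F^~ y)).
Proof. by rewrite /avg -!mulr_suml exchange_big mulrAC. Qed.

Lemma eq_avg (T : finType) (X : {set T}) (f g : T -> R) :
  f =1 g -> avg X f = avg X g.
Proof. by move=> fg; rewrite /avg (eq_bigr g). Qed.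

(** Since [i < j], part [l] never occurs on both sides of a pair: each term is constant in it or a
    single average over it. *)
Lemma density_update (T : finType) (k : nat) (b : T -> T -> R)
    (X : 'I_k -> {set T}) (l : 'I_k) (Y : {set T}) :
  (0 < #|Y|)%N ->
  density b (update X l Y) =
    avg Y (fun x => density b (update X l [set x])).
Proof.
move=> Y0; rewrite /density avg_sum; apply: eq_bigr => i _.
rewrite avg_sum; apply: eq_bigr => j ltij; rewrite /update /pair_density.
have [il|il] := eqVneq i l; have [jl|jl] := eqVneq j l.
- by rewrite il jl ltnn in ltij.
- by apply: eq_avg => x; rewrite avg1.
- by rewrite avg_exchange; apply: eq_avg => y; apply: eq_avg => x; rewrite avg1.
- by rewrite avg_const.
Qed.

Lemma eq_density (T : finType) (k : nat) (b : T -> T -> R)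
    (X Y : 'I_k -> {set T}) :
  X =1 Y -> density b X = density b Y.
Proof.
by move=> XY; rewrite /density; do 2!(apply: eq_bigr => ? _); rewrite !XY.
Qed.

(** * Cutting parts at a controlled cost in density *)

Section Shrinking.
Variables (T : finType) (k D : nat) (b : T -> T -> R).
Hypotheses (b0 : forall u w, 0 <= b u w) (D0 : (0 < D)%N).
Let r : R := 1 + D%:R^-1.

Let r0 : 0 <= r. Proof. by rewrite addr_ge0 // invr_ge0. Qed.
Let r1 : 1 <= r. Proof. by rewrite lerDl invr_ge0. Qed.

Lemma shrink_part (Q : finType) (h : T -> Q) (X : 'I_k -> {set T}) (l : 'I_k)
    (L : nat) :
  (0 < L)%N -> (0 < #|Q|)%N -> (block_size D #|Q| L <= #|X l|)%N ->
  exists Y : {set T},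
    [/\ Y \subset X l, #|Y| = L, {in Y &, forall x y, h x = h y}
      & density b (update X l Y) <= r * density b X].
Proof.
move=> L0 Q0 leX.
(* By [density_update], the averages of this function over [X l] and over [Y] are the densities
   before and after the cut. *)
have [Y [YX cY hY leY]] := avg_constant_block h (g := fun x =>
  density b (update X l [set x])) (fun=> density_ge0 _ b0) D0 L0 Q0 leX.
exists Y; split=> //; rewrite density_update ?cY // (le_trans leY) //.
rewrite -density_update; last first.
  by apply: leq_trans leX; rewrite !muln_gt0 Q0 L0.
rewrite (@eq_density _ _ _ _ X) // => i; rewrite /update.
by case: eqP => // ->.
Qed.

Lemma update_sub (X : 'I_k -> {set T}) (l : 'I_k) (Y : {set T}) :
  Y \subset X l -> forall i, update X l Y i \subset X i.
Proof. by move=> YX i; rewrite /update; case: eqP => // ->. Qed.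

Definition homogeneous (Q : Type) (c : T -> T -> Q) (U W : {set T}) : Prop :=
  forall u u' w w', u \in U -> u' \in U -> w \in W -> w' \in W ->
    c u w = c u' w'.

Lemma homogeneousS (Q : Type) (c : T -> T -> Q) (U U' W W' : {set T}) :
  U' \subset U -> W' \subset W -> homogeneous c U W -> homogeneous c U' W'.
Proof.
move=> /subsetP sU /subsetP sW hc u u' w w' uU u'U wW w'W.
by apply: hc; auto.
Qed.

(** The arguments of [maxn] serve the untouched parts, the cut of [X i] to size [m], and the cut of
    [X j] by its [q ^ m] color vectors. Size [m] permits the last cut of [X i]. *)
Definition pair_size (q L : nat) : nat :=
  let m := block_size D q L in
  maxn L (maxn (block_size D 1 m) (block_size D (q ^ m) L)).

(* Shrink [X i] to a bounded size, make all the colors [c u w] independent of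
   [w] in [X j] by partitioning [X j] according to its color vectors, and
   finally partition [X i]. *)
Lemma homogeneous_pair (Q : finType) (c : T -> T -> Q) (X : 'I_k -> {set T})
    (i j : 'I_k) (L : nat) :
  (0 < L)%N -> (0 < #|Q|)%N -> (forall l, pair_size #|Q| L <= #|X l|)%N ->
  exists Y : 'I_k -> {set T},
    [/\ forall l, Y l \subset X l, forall l, (L <= #|Y l|)%N,
        (i < j)%N -> homogeneous c (Y i) (Y j)
      & density b Y <= r ^+ 3 * density b X].
Proof.
move=> L0 Q0 leX; have LX l : (L <= #|X l|)%N.
  by apply: leq_trans (leX l); rewrite leq_maxl.
have [ltij|leji] := ltnP i j; last first.
  exists X; split=> //; rewrite ler_peMl ?density_ge0 //.
  exact: exprn_ege1.
have ij : i != j by apply: contraTneq ltij => ->; rewrite ltnn.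
set m := block_size D #|Q| L.
have m0 : (0 < m)%N by rewrite !muln_gt0 Q0 L0.
have [||A [AX cA _ leA]] := shrink_part (fun=> tt) (X := X) (l := i) m0.
- by rewrite card_unit.
- rewrite card_unit; apply: leq_trans (leX i).
  by rewrite /pair_size !leq_max leqnn orbT.
set X1 := update X i A in leA.
have X1j : X1 j = X j by rewrite /X1 /update eq_sym (negPf ij).
(* Indexing the vectors by [A] alone bounds their number in terms of [m], whatever the size of
   [T]. *)
pose h w := [ffun u : {u | u \in A} => c (val u) w].
have cF : #|{ffun {u | u \in A} -> Q}| = (#|Q| ^ m)%N.
  by rewrite card_ffun card_sig cA.
have [||C [CX cC hC leC]] := shrink_part h (X := X1) (l := j) L0.
- by rewrite cF expn_gt0 Q0.
- rewrite cF X1j; apply: leq_trans (leX j).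
  by rewrite /pair_size !leq_max leqnn !orbT.
set X2 := update X1 j C in leC.
have [w0 w0C] : exists w, w \in C by apply/card_gt0P; rewrite cC.
have X2i : X2 i = A by rewrite /X2 /X1 /update (negPf ij) eqxx.
have X2j : X2 j = C by rewrite /X2 /update eqxx.
(* One reference point [w0] suffices: each [u] in [A] sees a single color on all of [C]. *)
have [||E [EX cE hE leE]] := shrink_part (c^~ w0) (X := X2) (l := i) L0.
- exact: Q0.
- by rewrite X2i cA.
have X3i : update X2 i E i = E by rewrite /update eqxx.
have X3j : update X2 i E j = C by rewrite /update eq_sym (negPf ij) X2j.
have s1 := update_sub AX; have s2 := update_sub CX; have s3 := update_sub EX.
exists (update X2 i E); split.
- by move=> l; apply: subset_trans (s3 l) (subset_trans (s2 l) (s1 l)).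
- move=> l; have [->|li] := eqVneq l i; first by rewrite X3i cE.
  have [->|lj] := eqVneq l j; first by rewrite X3j cC.
  by rewrite /X2 /X1 /update (negPf li) (negPf lj).
- move=> _; rewrite X3i X3j => u u' w w' uE u'E wC w'C.
  rewrite X2i in EX.
  have colE v x : v \in E -> x \in C -> c v x = c v w0.
    move=> /(subsetP EX) vA xC.
    by have /ffunP/(_ (exist _ v vA)) := hC _ _ xC w0C; rewrite !ffunE.
  by rewrite !colE //; apply: hE.
- apply: (le_trans leE); rewrite exprS -mulrA; apply: ler_wpM2l => //.
  apply: (le_trans leC); rewrite exprS -mulrA; apply: ler_wpM2l => //.
Qed.

(** Homogeneity passes to subsets, so later cuts do not spoil earlier pairs. Sizes are computed
    backwards from [L], the outermost iteration paying for the first pair. *)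
Lemma homogeneous_pairs (Q : finType) (c : T -> T -> Q)
    (s : seq ('I_k * 'I_k)) (X : 'I_k -> {set T}) (L : nat) :
  (0 < L)%N -> (0 < #|Q|)%N ->
  (forall l, iter (size s) (pair_size #|Q|) L <= #|X l|)%N ->
  exists Y : 'I_k -> {set T},
    [/\ forall l, Y l \subset X l, forall l, (L <= #|Y l|)%N,
        {in s, forall p : 'I_k * 'I_k,
          (p.1 < p.2)%N -> homogeneous c (Y p.1) (Y p.2)}
      & density b Y <= r ^+ (3 * size s) * density b X].
Proof.
move=> L0 Q0; elim: s X => [|p s IHs] X leX.
  by exists X; split=> //; rewrite mul1r.
have LI : (0 < iter (size s) (pair_size #|Q|) L)%N.
  elim: (size s) => //= n IHn; exact: leq_trans IHn (leq_maxl _ _).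
have [Y [YX cY hY leY]] := homogeneous_pair c p.1 p.2 LI Q0 leX.
have [Z [ZY cZ hZ leZ]] := IHs Y cY.
exists Z; split=> //.
- by move=> l; apply: subset_trans (ZY l) (YX l).
- move=> p'; rewrite inE => /predU1P[->|/hZ//] lt.
  exact: homogeneousS (hY lt).
- rewrite /= mulnS addnC exprD -mulrA (le_trans leZ) //.
  by apply: ler_wpM2l leY; apply: exprn_ge0.
Qed.

(** The clause on parts outside [s] carries the induction: the next part to be cut still has its
    original size. *)
Lemma equalize_parts (s : seq 'I_k) (X : 'I_k -> {set T}) (t : nat) :
  (0 < t)%N -> uniq s -> (forall l, block_size D 1 t <= #|X l|)%N ->
  exists Y : 'I_k -> {set T},
    [/\ forall l, Y l \subset X l, {in s, forall l, #|Y l| = t},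
        forall l, l \notin s -> Y l = X l
      & density b Y <= r ^+ size s * density b X].
Proof.
move=> t0; elim: s => [|l s IHs] /= us leX.
  by exists X; split=> //; rewrite mul1r.
have /andP[ls {}us] := us.
have [Y [YX cY eY leY]] := IHs us leX.
have [||A [AX cA _ leA]] := shrink_part (fun=> tt) (X := Y) (l := l) t0.
- by rewrite card_unit.
- by rewrite card_unit eY.
exists (update Y l A); split.
- by move=> i; apply: subset_trans (update_sub AX i) (YX i).
- move=> i; rewrite inE /update; case: eqP => //= _; exact: cY.
- by move=> i; rewrite inE /update; case: eqP => //= _; apply: eY.
- by rewrite exprS -mulrA (le_trans leA) // ler_wpM2l.
Qed.

End Shrinking.
End Averages.

(** The right side is the chord over [[0, 1]] of a convex function; being linear in [x], it turns
    the accumulated loss into a condition on [D]. *)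
Lemma exprn_1D_le (R : realFieldType) (x : R) (K : nat) :
  0 <= x <= 1 -> (1 + x) ^+ K <= 1 + (2 ^+ K - 1) * x.
Proof.
case/andP=> x0 x1; elim: K => [|K IHK]; first by rewrite subrr mul0r addr0.
have p0 : 0 <= 2 ^+ K - 1 :> R by rewrite subr_ge0 exprn_ege1 // ler1n.
rewrite exprSr exprSr; apply: le_trans (ler_wpM2r _ IHK) _; first lra.
have := ler_wpM2l (mulr_ge0 p0 x0) x1; lra.
Qed.

(** * Counting undesirable edges through densities *)

Definition indicator (R : realFieldType) (T : finType) (B : {set {set T}})
  (u w : T) : R := ([set u; w] \in B)%:R.

Lemma pair_density_equal_size (R : realFieldType) (T : finType)
    (b : T -> T -> R) (n : nat) (U W : {set T}) :
  (0 < n)%N -> #|U| = n -> #|W| = n ->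
  n%:R ^+ 2 * pair_density b U W = \sum_(u in U) \sum_(w in W) b u w.
Proof.
move=> n0 cU cW; rewrite /pair_density /avg cU cW -mulr_suml -mulrA -invfM.
by rewrite mulrC expr2 mulfVK // mulf_neq0 // pnatr_eq0 -lt0n.
Qed.

Lemma density_equal_size (R : realFieldType) (T : finType) (k n : nat)
    (b : T -> T -> R) (X : 'I_k -> {set T}) :
  (0 < n)%N -> (forall i, #|X i| = n) ->
  n%:R ^+ 2 * density b X =
    \sum_(i < k) \sum_(j < k | (i < j)%N) \sum_(u in X i) \sum_(w in X j) b u w.
Proof.
move=> n0 cX; rewrite mulr_sumr; apply: eq_bigr => i _.
by rewrite mulr_sumr; apply: eq_bigr => j _; apply: pair_density_equal_size.
Qed.

Lemma card_cross_edges_le (T : finType) (B : {set {set T}}) (U W : {set T}) :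
  (#|B :&: cross_edges U W| <=
    \sum_(u in U) \sum_(w in W) ([set u; w] \in B))%N.
Proof.
set S := [set p | [&& p.1 \in U, p.2 \in W & [set p.1; p.2] \in B]].
have -> : (\sum_(u in U) \sum_(w in W) ([set u; w] \in B) = #|S|)%N.
  rewrite pair_big /= -sum1_card big_mkcond [RHS]big_mkcond /=.
  apply: eq_bigr => p _; rewrite !inE andbA.
  by case: ifP => //= _; case: (_ \in B).
apply: leq_trans (leq_imset_card (fun p : T * T => [set p.1; p.2]) S).
apply/subset_leq_card/subsetP => e; rewrite inE.
move=> /andP[eB /imset2P[u w uU wW ee]].
by apply/imsetP; exists (u, w) => //; rewrite inE /= uU wW -ee.
Qed.

Lemma card_partite_edges_le (T : finType) (k : nat) (B : {set {set T}})
    (X : 'I_k -> {set T}) :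
  (#|B :&: partite_edges X| <=
    \sum_(i < k) \sum_(j < k | i < j)
      \sum_(u in X i) \sum_(w in X j) ([set u; w] \in B))%N.
Proof.
have cardU (I : finType) (P : pred I) (F : I -> {set {set T}}) :
    (#|B :&: \bigcup_(i | P i) F i| <= \sum_(i | P i) #|B :&: F i|)%N.
  elim/big_rec2: _ => [|i m A _ IH]; first by rewrite setI0 cards0.
  by rewrite setIUr (leq_trans (leq_card_setU _ _)) ?leq_add2l.
apply: leq_trans (cardU _ _ _) _; apply: leq_sum => i _.
apply: leq_trans (cardU _ _ _) _; apply: leq_sum => j _.
exact: card_cross_edges_le.
Qed.

(** Disjointness lets an edge determine the parts of its ends, and [i < j] their order, so no edge
    is counted twice. *)
Lemma sum_edges_le_card (T : finType) (k : nat) (B : {set {set T}})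
    (X : 'I_k -> {set T}) :
  (forall i j : 'I_k, i != j -> [disjoint X i & X j]) ->
  (\sum_(i < k) \sum_(j < k | i < j)
      \sum_(u in X i) \sum_(w in X j) ([set u; w] \in B) <= #|B|)%N.
Proof.
move=> dX.
have uX i j x : x \in X i -> x \in X j -> i = j.
  move=> xi xj; apply/eqP; apply: contraLR xj => /dX /disjointFr -> //.
pose S := [set p : ('I_k * 'I_k) * (T * T) |
  [&& (p.1.1 < p.1.2)%N, p.2.1 \in X p.1.1, p.2.2 \in X p.1.2
    & [set p.2.1; p.2.2] \in B]].
have -> : (\sum_(i < k) \sum_(j < k | i < j)
    \sum_(u in X i) \sum_(w in X j) ([set u; w] \in B) = #|S|)%N.
  rewrite pair_big_dep /=.
  under eq_bigr do rewrite pair_big /=.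
  rewrite pair_big_dep /= -sum1_card big_mkcond [RHS]big_mkcond /=.
  apply: eq_bigr => p _; rewrite !inE /=.
  by do 3![case: (X in if X && _ then _ else _) => //=]; case: (_ \in B).
rewrite -(card_in_imset (f := fun p => [set p.2.1; p.2.2])).
  apply/subset_leq_card/subsetP => e /imsetP[p + ->].
  by rewrite inE => /and4P[].
move=> [[i j] [u w]] [[i' j'] [u' w']]; rewrite !inE /=.
move=> /and4P[ij ui wj _] /and4P[ij' ui' wj' _] ee.
have /set2P[uu|uw] : u \in [set u'; w'] by rewrite -ee set21.
  have /set2P[wu|ww] : w \in [set u'; w'] by rewrite -ee set22.
    move: ij; rewrite uu in ui; rewrite wu in wj.
    by rewrite (uX _ _ _ ui wj) ltnn.
  by subst; rewrite (uX _ _ _ ui ui') (uX _ _ _ wj wj').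
(* With [u = w'], the case [w = u'] gives [i = j'] and [j = i'], reversing the order; the case
   [w = w'] gives [i = j]. *)
have /set2P[wu|ww] : w \in [set u'; w'] by rewrite -ee set22.
  subst; move: ij'; rewrite -(uX _ _ _ ui wj') -(uX _ _ _ wj ui').
  by move/(ltn_trans ij); rewrite ltnn.
move: ij; rewrite uw in ui; rewrite ww in wj.
by rewrite (uX _ _ _ ui wj) ltnn.
Qed.

Theorem theorem4p1 (R : realType) :
  exists N : nat -> nat -> nat -> R -> nat,
    forall (Sigma T : finType) (k t n : nat) (alpha eps : R)
           (G : chart Sigma T k) (B : {set {set T}}),
      0 < alpha <= 1 ->
      (forall i : 'I_k, #|part G i| = n) ->
      (N #|Sigma| k t alpha <= n)%N ->
      B \subset partite_edges (part G) ->
      #|B|%:R <= eps * 'C(k, 2)%:R * n%:R ^+ 2 ->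
      exists W : 'I_k -> {set T},
        [/\ forall i : 'I_k, W i \subset part G i,
            forall i : 'I_k, #|W i| = t,
            forall i j : 'I_k, (i < j)%N ->
              color_constant_on G (cross_edges (W i) (W j))
          & #|B :&: partite_edges W|%:R
              <= (1 + alpha) * eps * 'C(k, 2)%:R * t%:R ^+ 2].
Proof.
(* [homogeneous_pairs] costs a factor [1 + 1/D] three times for each of the
   [k * k] ordered pairs, [equalize_parts] once for each part. *)
pose K k := (k + 3 * (k * k))%N.
(* This exceeds [2 ^+ K k / alpha], so the chord bound at [1 / D] is at most [1 + alpha]. *)
pose D k (alpha : R) := (Num.bound (2 ^+ K k / alpha)).+1.
exists (fun s k t alpha => maxn 1 (iter (k * k) (pair_size (D k alpha) s.+1)
  (block_size (D k alpha) 1 t))).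
move=> Sigma T k t n alpha eps G B /andP[a0 a1] cV leN sB leB.
(* The cuts produce blocks of positive size only, so [t = 0] is settled by empty sets. *)
have [->|t0] := posnP t.
  exists (fun=> set0); split=> [i|i|i j _ e f|].
  - exact: sub0set.
  - exact: cards0.
  - by case/imset2P=> u w; rewrite inE.
  rewrite expr0n mulr0 (_ : _ :&: _ = set0) ?cards0 //.
  apply/setP => e; rewrite !inE; apply/negbTE; rewrite negb_and orbC.
  apply/orP; left; apply/negP => /bigcupP[i _ /bigcupP[j _]].
  by case/imset2P=> u w; rewrite inE.
have n0 : (0 < n)%N by apply: leq_trans leN; rewrite leq_maxl.
set d := D k alpha in leN.
(* [color] is only defined on edges; [c] is [None] elsewhere, hence the [s.+1]
   colors above. *)
pose c u w := omap (@color _ _ _ G) (insub [set u; w]).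
pose b := @indicator R T B.
have b0 u w : 0 <= b u w by rewrite ler0n.
have d0 : (0 < d)%N by [].
have L0 : (0 < block_size d 1 t)%N by rewrite !muln_gt0 t0.
have cP : size (enum {: 'I_k * 'I_k}) = (k * k)%N.
  by rewrite -cardE card_prod card_ord.
have [||X [XV cX hX leX]] := homogeneous_pairs (D := d) b0 d0 c
    (s := enum {: 'I_k * 'I_k}) (X := part G) L0.
- by rewrite card_option.
- move=> l; rewrite cV cP card_option; apply: leq_trans leN.
  by rewrite leq_maxr.
have [W [WX cW _ leW]] :=
  equalize_parts b0 d0 t0 (enum_uniq 'I_k) cX.
exists W; split.
- by move=> i; apply: subset_trans (WX i) (XV i).
- by move=> i; apply: cW; rewrite mem_enum.
- move=> i j ij e f /imset2P[u w uW wW ee] /imset2P[u' w' u'W w'W ef].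
  have hij : homogeneous c (X i) (X j).
    by apply: (hX (i, j)); rewrite ?mem_enum.
  have := homogeneousS (WX i) (WX j) hij uW u'W wW w'W.
  (* On genuine edges [insub] succeeds, and [Some] is injective. *)
  by rewrite /c -ee -ef !valK => -[].
have {cW} cW i : #|W i| = t by apply: cW; rewrite mem_enum.
have grow : density b W <= (1 + alpha) * density b (part G).
  apply: (le_trans leW); apply: le_trans (ler_wpM2l _ leX) _.
    by rewrite exprn_ge0 // addr_ge0 // invr_ge0.
  rewrite mulrA cP -cardE card_ord -exprD ler_wpM2r ?density_ge0 //.
  have d1 : 0 <= (d%:R^-1 : R) <= 1.
    by rewrite invr_ge0 ler0n invf_le1 ?ltr0n // ler1n.
  apply: le_trans (exprn_1D_le _ d1) _; rewrite lerD2l.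
  rewrite ler_pdivrMr ?ltr0n //.
  have : 2 ^+ K k / alpha <= d%:R.
    apply/ltW; apply: lt_trans (archi_boundP _) _.
      by rewrite divr_ge0 ?exprn_ge0 // ltW.
    by rewrite ltr_nat.
  rewrite ler_pdivrMr // mulrC.
  by apply: le_trans; rewrite gerBl.
have natsum (Y : 'I_k -> {set T}) (m : nat) :
    (0 < m)%N -> (forall i, #|Y i| = m) ->
    m%:R ^+ 2 * density b Y = (\sum_(i < k) \sum_(j < k | (i < j)%N)
      \sum_(u in Y i) \sum_(w in Y j) ([set u; w] \in B))%:R.
  move=> m0 cY; rewrite density_equal_size // natr_sum; apply: eq_bigr => i _.
  rewrite natr_sum; apply: eq_bigr => j _.
  by rewrite natr_sum; apply: eq_bigr => u _; rewrite natr_sum.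
have dV : density b (part G) <= eps * 'C(k, 2)%:R.
  have n2 : 0 < n%:R ^+ 2 :> R by rewrite exprn_gt0 ?ltr0n.
  rewrite -(ler_pM2r n2); apply: le_trans leB.
  rewrite mulrC natsum // ler_nat; apply: sum_edges_le_card.
  exact: part_disjoint.
apply: (@le_trans _ _ (t%:R ^+ 2 * density b W)).
  by rewrite natsum // ler_nat card_partite_edges_le.
rewrite mulrC ler_wpM2r ?exprn_ge0 // (le_trans grow) // -mulrA.
by rewrite ler_wpM2l // addr_ge0 // ltW.
Qed.
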